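(* Let $k,m\ge 1$ be integers, let $d_1,\dots,d_k,n_1,\dots,n_m$ be positive integers, let $\mathscr{A}_{ij}$ be a finite index set for each $(i,j)\in[k]\times[m]$, and let $\mathbf p=(p_1,\dots,p_m)\in\mathbb{Q}_{>0}^m$ satisfy $\sum_{i=1}^k d_i=\sum_{j=1}^m p_jn_j$. Let $$\mathcal S:=\Big\{V\in\prod_{(i,j)\in[k]\times[m]}\ \prod_{a\in\mathscr{A}_{ij}}\mathbb{R}^{n_j\times d_i}\ \Big|\ (V,\mathbf p)\text{ is feasible}\Big\}.$$ Then $\mathbf{cap}_{\mathcal Q}(-,\mathbf p):\mathcal S\to\mathbb{R}$ is a semi-algebraic function. Consequently, it is an algebraic function, in the sense that there exists a non-zero real polynomial $P$ in $1+\sum_{i,j}|\mathscr{A}_{ij}|d_in_j$ variables such that $$P(V,\mathbf{cap}_{\mathcal Q}(V,\mathbf p))=0\qquad\text{for all }V\in\mathcal S.$$ In particular, the classical Brascamp-Lieb constant (i.e. $V\mapsto \mathrm{BL}_{\mathcal Q}(V,\mathbf p)$ in the case where $k=1$ and every $\mathscr{A}_{1j}$ is a singleton) is a semi-algebraic, hence algebraic, function on the set of feasible data.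
   Context: Notation: $[r]=\{1,\dots,r\}$. The sets $[k]$, $[m]$, $\mathscr{A}_{ij}$ are viewed as a bipartite quiver $\mathcal Q$ with $k$ source vertices, $m$ sink vertices, and arrows from source $i$ to sink $j$ labeled by the elements of $\mathscr{A}_{ij}$. A quiver datum is a pair $(V,\mathbf p)$ with $V=(V_a\in\mathbb{R}^{n_j\times d_i}\mid a\in\mathscr{A}_{ij},\,i\in[k],\,j\in[m])$ a tuple of real matrices. Let $\mathsf{PD}_n$ be the set of real (symmetric) positive definite $n\times n$ matrices. Capacity: $$\mathbf{cap}_{\mathcal Q}(V,\mathbf p)=\inf\left\{\frac{\prod_{i=1}^k\det\left(\sum_{j=1}^m p_j\sum_{a\in\mathscr{A}_{ij}}V_a^{\top}Y_jV_a\right)}{\prod_{j=1}^m\det(Y_j)^{p_j}}\ \middle|\ Y_j\in\mathsf{PD}_{n_j},\ j\in[m]\right\}.$$ Quiver Brascamp-Lieb constant: $\mathrm{BL}_{\mathcal Q}(V,\mathbf p)=1/\sqrt{\mathbf{cap}_{\mathcal Q}(V,\mathbf p)}$. The datum $(V,\mathbf p)$ is feasible if $\mathbf{cap}_{\mathcal Q}(V,\mathbf p)>0$, equivalently $\mathrm{BL}_{\mathcal Q}(V,\mathbf p)<\infty$. A subset of $\mathbb{R}^D$ is semi-algebraic if it is a finite union of sets each defined by finitely many polynomial equalities and strict inequalities. A map between semi-algebraic sets is semi-algebraic if its graph is semi-algebraic. A function $F:X\to\mathbb{R}$ with $X\subseteq\mathbb{R}^D$ is algebraic if there is a nonzero polynomial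 $P(x,t)\in\mathbb{R}[x_1,\dots,x_D,t]$ with $P(x,F(x))=0$ for all $x\in X$. *)

(* Defs.v *)
From mathcomp Require Import all_boot all_order all_algebra.
From mathcomp Require Import mpoly.
From mathcomp Require Import boolp classical_sets reals constructive_ereal exp.

Set Implicit Arguments.
Unset Strict Implicit.
Unset Printing Implicit Defensive.

Import Order.TTheory GRing.Theory Num.Theory.
Local Open Scope classical_set_scope.
Local Open Scope ring_scope.

Section SemiAlgebraic.
Variable R : realType.

(* Points of R^D are row vectors. *)
Definition basic_semialgebraic (D : nat) (eqs ineqs : seq {mpoly R[D]}) :
    set 'rV[R]_D :=
  [set x | (forall f, f \in eqs -> f.@[x 0] = 0) /\
           (forall g, g \in ineqs -> 0 < g.@[x 0])].

Definition semialgebraic (D : nat) (X : set 'rV[R]_D) : Prop :=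
  exists s : seq (seq {mpoly R[D]} * seq {mpoly R[D]}),
    X = [set x | exists2 c, c \in s & basic_semialgebraic c.1 c.2 x].

Definition graph_on (D E : nat) (X : set 'rV[R]_D) (F : 'rV[R]_D -> 'rV[R]_E) :
    set 'rV[R]_(D + E) :=
  [set y | exists2 x, X x & y = row_mx x (F x)].

(* A map X -> Y is a total function of which only the values on X matter. *)
Definition semialgebraic_map (D E : nat) (X : set 'rV[R]_D) (Y : set 'rV[R]_E)
    (F : 'rV[R]_D -> 'rV[R]_E) : Prop :=
  [/\ semialgebraic X, semialgebraic Y, (forall x, X x -> Y (F x)) &
      semialgebraic (graph_on X F)].

Definition semialgebraic_fun (D : nat) (X : set 'rV[R]_D) (F : 'rV[R]_D -> R) :
    Prop :=
  semialgebraic_map X [set: 'rV[R]_1] (fun x => (F x)%:M).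

Definition algebraic_fun (D : nat) (X : set 'rV[R]_D) (F : 'rV[R]_D -> R) :
    Prop :=
  exists P : {mpoly R[D + 1]},
    P != 0 /\ forall x, X x -> P.@[row_mx x (F x)%:M 0] = 0.

End SemiAlgebraic.

Definition posdef_mx (R : realType) (n : nat) (Y : 'M[R]_n) : Prop :=
  Y^T = Y /\ forall x : 'cV[R]_n, x != 0 -> 0 < (x^T *m Y *m x) 0 0.

Section QuiverDatum.
Variables (R : realType) (k m : nat) (d : 'I_k -> nat) (n : 'I_m -> nat).
Variable A : 'I_k -> 'I_m -> finType.

Definition quiver_rep : Type :=
  forall (i : 'I_k) (j : 'I_m), A i j -> 'M[R]_(n j, d i).

Definition cap_ratio (V : quiver_rep) (p : 'I_m -> rat)
    (Y : forall j : 'I_m, 'M[R]_(n j)) : R :=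
  (\prod_(i < k) \det (\sum_(j < m) (ratr (p j) : R) *:
       \sum_(a : A i j) (V i j a)^T *m Y j *m V i j a))
  / \prod_(j < m) (\det (Y j)) `^ ratr (p j).

Definition capacity (V : quiver_rep) (p : 'I_m -> rat) : R :=
  inf [set c : R | exists2 Y : forall j : 'I_m, 'M[R]_(n j),
                     (forall j, posdef_mx (Y j)) & c = cap_ratio V p Y].

(* In \bar R the inverse of 0 is +oo. *)
Definition BL_constant (V : quiver_rep) (p : 'I_m -> rat) : \bar R :=
  ((Num.sqrt (capacity V p))%:E)^-1%E.

Definition feasible (V : quiver_rep) (p : 'I_m -> rat) : Prop :=
  0 < capacity V p.

Definition quiver_dim : nat :=
  (\sum_(i < k) \sum_(j < m) #|A i j| * d i * n j)%N.

(* One coordinate for each entry (r, c) of each matrix V_a, a in A i j. *)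
Definition quiver_coord : finType :=
  {i : 'I_k & {j : 'I_m & (A i j * ('I_(n j) * 'I_(d i)))%type}}.

Lemma card_quiver_coord : #|quiver_coord| = quiver_dim.
Proof.
rewrite card_tagged sumnE big_map big_enum; apply: eq_bigr => i _ /=.
rewrite card_tagged sumnE big_map big_enum; apply: eq_bigr => j _ /=.
by rewrite !card_prod !card_ord mulnA mulnAC.
Qed.

Definition coord_of (l : 'I_quiver_dim) : quiver_coord :=
  enum_val (cast_ord (esym card_quiver_coord) l).

Definition coord_index (c : quiver_coord) : 'I_quiver_dim :=
  cast_ord card_quiver_coord (enum_rank c).

Lemma coord_ofK : cancel coord_of coord_index.
Proof. by move=> l; rewrite /coord_index /coord_of enum_valK cast_ordKV. Qed.

Lemma coord_indexK : cancel coord_index coord_of.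
Proof. by move=> c; rewrite /coord_index /coord_of cast_ordK enum_rankK. Qed.

(* quiver_vec and quiver_unvec identify the space of data with R^quiver_dim. *)
Definition quiver_vec (V : quiver_rep) : 'rV[R]_quiver_dim :=
  \row_l let: existT i (existT j (a, (r, c))) := coord_of l in V i j a r c.

Definition quiver_unvec (x : 'rV[R]_quiver_dim) : quiver_rep :=
  fun i j a => \matrix_(r, c) x 0 (coord_index
    (@Tagged _ i (fun i' => {j' : 'I_m & (A i' j' * ('I_(n j') * 'I_(d i')))%type})
      (@Tagged _ j (fun j' => (A i j' * ('I_(n j') * 'I_(d i)))%type)
        (a, (r, c))))).

Lemma quiver_vecK : cancel quiver_vec quiver_unvec.
Proof.
move=> V; apply: functional_extensionality_dep => i.
apply: functional_extensionality_dep => j.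
apply: functional_extensionality_dep => a.
by apply/matrixP => r c; rewrite !mxE coord_indexK.
Qed.

Lemma quiver_unvecK : cancel quiver_unvec quiver_vec.
Proof.
move=> x; apply/rowP => l; rewrite mxE -[in RHS](coord_ofK l).
by case: (coord_of l) => i [j [a [r c]]]; rewrite mxE.
Qed.

Definition feasible_set (p : 'I_m -> rat) : set 'rV[R]_quiver_dim :=
  quiver_vec @` [set V | feasible V p].

End QuiverDatum.

(* Main.v *)
Require Import Defs.
From mathcomp Require Import all_boot all_order all_algebra.
From mathcomp Require Import mpoly.
From mathcomp Require Import boolp classical_sets reals constructive_ereal exp.
From mathcomp Require Import polyrcf ordered_qelim.
From mathcomp Require qe_rcf.

(** The capacity is described by a first-order formula over the ordered field
of real numbers, and by quantifier elimination (Tarski and Seidenberg) a set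
defined by such a formula is semialgebraic.

Quantifier elimination enters once, in [definable_semialgebraic]. Its
consequence [semialgebraic_exists] says that semialgebraic sets are stable
under projection; together with complements and polynomial substitutions this
lets every later definition be read off quantifier by quantifier.

Two points stand between the definition of the capacity and such a formula.
- The exponents [p j] are rational, so [det (Y j) `^ p j] is not a polynomial.
  Let [N] be a common denominator, [p j * N = a j]. Determinants of positive
  definite matrices are positive ([posdef_det_gt0]), so the denominator of the
  ratio is the unique [w > 0] whose [N]-th power is the polynomial
  [\prod_j det (Y j) ^ a j] ([cap_ratioP]).
- The infimum of a set of reals without a lower bound, or of the empty set, is
  the default value [0]. On feasible data the capacity is positive, and a
  positive number is the infimum exactly when it is the greatest lower bound,
  which is a first-order condition ([pos_infP]).
So the set of pairs (datum, capacity) with positive capacity is semialgebraic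
([semialgebraic_inf]); this is the graph of the capacity on the feasible
set, and the feasible set is its projection.

A semialgebraic function is algebraic ([semialgebraic_algebraic]): the graph
is a finite union of basic pieces. A nonempty piece without a nontrivial
equation would be open and so contain two points on the same vertical line,
which is impossible in a graph. One nonzero equation from each nonempty
piece therefore gives a product that vanishes on the graph.

The Brascamp-Lieb constant is the [b > 0] with [b ^+ 2 * c = 1], where [c] is
the capacity, so its graph is again a projection of a semialgebraic set. *)

Set Implicit Arguments.
Unset Strict Implicit.
Unset Printing Implicit Defensive.

Import Order.TTheory GRing.Theory Num.Theory.

Local Open Scope classical_set_scope.
Local Open Scope ring_scope.

(** * Polynomial functions of a row vector *)

Section PolynomialFunctions.
Variables (R : realType) (D : nat).
Implicit Types F G : 'rV[R]_D -> R.

Definition polyfun F := exists f : {mpoly R[D]}, forall x, F x = f.@[x 0].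

Lemma polyfun_ext F G : F =1 G -> polyfun G -> polyfun F.
Proof. by move=> FG [g Gg]; exists g => x; rewrite FG. Qed.

Lemma polyfun_cst c : polyfun (fun=> c).
Proof. by exists c%:MP_[D] => x; rewrite mevalC. Qed.

Lemma polyfun_coord l : polyfun (fun x => x 0 l).
Proof. by exists 'X_l => x; rewrite mevalXU. Qed.

Lemma polyfunD F G : polyfun F -> polyfun G -> polyfun (fun x => F x + G x).
Proof. by move=> [f Ff] [g Gg]; exists (f + g) => x; rewrite mevalD Ff Gg. Qed.

Lemma polyfunM F G : polyfun F -> polyfun G -> polyfun (fun x => F x * G x).
Proof. by move=> [f Ff] [g Gg]; exists (f * g) => x; rewrite mevalM Ff Gg. Qed.

Lemma polyfunN F : polyfun F -> polyfun (fun x => - F x).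
Proof. by move=> [f Ff]; exists (- f) => x; rewrite mevalN Ff. Qed.

Lemma polyfunB F G : polyfun F -> polyfun G -> polyfun (fun x => F x - G x).
Proof. by move=> pF pG; apply: polyfunD => //; apply: polyfunN. Qed.

Lemma polyfunX F e : polyfun F -> polyfun (fun x => F x ^+ e).
Proof. by move=> [f Ff]; exists (f ^+ e) => x; rewrite rmorphXn /= Ff. Qed.

Lemma polyfun_sum I (r : seq I) (P : pred I) (H : I -> 'rV[R]_D -> R) :
  (forall i, P i -> polyfun (H i)) ->
  polyfun (fun x => \sum_(i <- r | P i) H i x).
Proof.
move=> pH; elim: r => [|i r IHr].
  by apply: polyfun_ext (polyfun_cst 0) => x; rewrite big_nil.
have [Pi|nPi] := boolP (P i).
  by apply: polyfun_ext (polyfunD (pH i Pi) IHr) => x; rewrite big_cons Pi.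
by apply: polyfun_ext IHr => x; rewrite big_cons (negPf nPi).
Qed.

Lemma polyfun_prod I (r : seq I) (P : pred I) (H : I -> 'rV[R]_D -> R) :
  (forall i, P i -> polyfun (H i)) ->
  polyfun (fun x => \prod_(i <- r | P i) H i x).
Proof.
move=> pH; elim: r => [|i r IHr].
  by apply: polyfun_ext (polyfun_cst 1) => x; rewrite big_nil.
have [Pi|nPi] := boolP (P i).
  by apply: polyfun_ext (polyfunM (pH i Pi) IHr) => x; rewrite big_cons Pi.
by apply: polyfun_ext IHr => x; rewrite big_cons (negPf nPi).
Qed.

(** Entrywise polynomial maps. Determinants, products and coordinate changes
between spaces of row vectors are then handled by one set of closure lemmas. *)
Definition polymx a b (M : 'rV[R]_D -> 'M[R]_(a, b)) :=
  forall i j, polyfun (fun x => M x i j).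

Lemma polyfun_entry a b (M : 'rV[R]_D -> 'M[R]_(a, b)) i j :
  polymx M -> polyfun (fun x => M x i j).
Proof. exact. Qed.

Lemma polymx_id : polymx (fun x => x).
Proof. by move=> i l; rewrite ord1; apply: polyfun_coord. Qed.

Lemma polymx_sum I (r : seq I) a b (M : I -> 'rV[R]_D -> 'M[R]_(a, b)) :
  (forall h, polymx (M h)) -> polymx (fun x => \sum_(h <- r) M h x).
Proof.
move=> pM i j; apply: (@polyfun_ext _ (fun x => \sum_(h <- r) M h x i j)).
  by move=> x; rewrite summxE.
by apply: polyfun_sum => h _; apply: pM.
Qed.

Lemma polymxZ a b F (M : 'rV[R]_D -> 'M[R]_(a, b)) :
  polyfun F -> polymx M -> polymx (fun x => F x *: M x).
Proof.
move=> pF pM i j; apply: polyfun_ext (polyfunM pF (pM i j)) => x.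
by rewrite mxE.
Qed.

Lemma polymx_tr a b (M : 'rV[R]_D -> 'M[R]_(a, b)) :
  polymx M -> polymx (fun x => (M x)^T).
Proof. by move=> pM i j; apply: polyfun_ext (pM j i) => x; rewrite mxE. Qed.

Lemma polymxM a b c (M : 'rV[R]_D -> 'M[R]_(a, b))
    (N : 'rV[R]_D -> 'M[R]_(b, c)) :
  polymx M -> polymx N -> polymx (fun x => M x *m N x).
Proof.
move=> pM pN i j; apply: (@polyfun_ext _ (fun x => \sum_l M x i l * N x l j)).
  by move=> x; rewrite mxE.
by apply: polyfun_sum => l _; apply: polyfunM.
Qed.

Lemma polyfun_det a (M : 'rV[R]_D -> 'M[R]_a) :
  polymx M -> polyfun (fun x => \det (M x)).
Proof.
move=> pM; apply: polyfun_sum => s _; apply: polyfunM; first exact: polyfun_cst.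
by apply: polyfun_prod => i _.
Qed.

Lemma polymx_row a b (M : 'rV[R]_D -> 'rV[R]_a) (N : 'rV[R]_D -> 'rV[R]_b) :
  polymx M -> polymx N -> polymx (fun x => row_mx (M x) (N x)).
Proof.
move=> pM pN i j; case: (split_ordP j) => l ->.
  by apply: polyfun_ext (pM i l) => x; rewrite row_mxEl.
by apply: polyfun_ext (pN i l) => x; rewrite row_mxEr.
Qed.

Lemma polymx_lsub a b c (M : 'rV[R]_D -> 'M[R]_(c, a + b)) :
  polymx M -> polymx (fun x => lsubmx (M x)).
Proof.
by move=> pM i j; apply: polyfun_ext (pM i (lshift b j)) => x; rewrite mxE.
Qed.

Lemma polymx_rsub a b c (M : 'rV[R]_D -> 'M[R]_(c, a + b)) :
  polymx M -> polymx (fun x => rsubmx (M x)).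
Proof.
by move=> pM i j; apply: polyfun_ext (pM i (rshift a j)) => x; rewrite mxE.
Qed.

End PolynomialFunctions.

Lemma polymx_lproj (R : realType) a b :
  polymx (fun z : 'rV[R]_(a + b) => lsubmx z).
Proof. exact/polymx_lsub/polymx_id. Qed.

Lemma polymx_rproj (R : realType) a b :
  polymx (fun z : 'rV[R]_(a + b) => rsubmx z).
Proof. exact/polymx_rsub/polymx_id. Qed.

Lemma polymx_rlproj (R : realType) a b c :
  polymx (fun z : 'rV[R]_(a + b + c) => rsubmx (lsubmx z)).
Proof. exact/polymx_rsub/polymx_lproj. Qed.

Lemma polymx_llproj (R : realType) a b c :
  polymx (fun z : 'rV[R]_(a + b + c) => lsubmx (lsubmx z)).
Proof. exact/polymx_lsub/polymx_lproj. Qed.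

#[local] Hint Resolve polymx_lproj polymx_rproj : core.
#[local] Hint Resolve polymx_rlproj polymx_llproj : core.

Lemma polyfun_comp (R : realType) D E (F : 'rV[R]_E -> R)
    (G : 'rV[R]_D -> 'rV[R]_E) :
  polyfun F -> polymx G -> polyfun (F \o G).
Proof.
move=> [f Ff] pG; apply: (@polyfun_ext _ _ _ (fun x => \sum_(m <- msupp f)
   f@_m * \prod_i G x 0 i ^+ m i)).
  by move=> x /=; rewrite Ff mevalE.
apply: polyfun_sum => m _; apply: polyfunM; first exact: polyfun_cst.
by apply: polyfun_prod => i _; apply: polyfunX; apply: pG.
Qed.

(** * Boolean operations on semialgebraic sets *)

Lemma forall_in_cons (T : eqType) (P : T -> Prop) a s :
  (forall x, x \in a :: s -> P x) <-> P a /\ forall x, x \in s -> P x.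
Proof. exact: forall_cons. Qed.

Section Definability.
Variable R : realType.

(** Set-builder expressions are rarely equal on the nose; this transports
semialgebraicity along a pointwise equivalence. *)
Lemma semialgebraic_ext D (X Y : set 'rV[R]_D) :
  (forall x, X x <-> Y x) -> semialgebraic X -> semialgebraic Y.
Proof. by move=> XY; congr (semialgebraic _); apply/seteqP; split=> x /XY. Qed.

Lemma semialgebraic_basic D (es gs : seq {mpoly R[D]}) :
  semialgebraic (basic_semialgebraic es gs).
Proof.
exists [:: (es, gs)]; apply/seteqP; split => x /=.
  by move=> bx; exists (es, gs) => //; rewrite inE.
by case=> c; rewrite inE => /eqP ->.
Qed.

Lemma semialgebraicT D : semialgebraic [set: 'rV[R]_D].
Proof.
by apply: semialgebraic_ext (semialgebraic_basic [::] [::]) => x; split.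
Qed.

Lemma semialgebraic0 D : semialgebraic (set0 : set 'rV[R]_D).
Proof. by exists [::]; apply/seteqP; split => x //= -[]. Qed.

Lemma semialgebraicU D (X Y : set 'rV[R]_D) :
  semialgebraic X -> semialgebraic Y -> semialgebraic (X `|` Y).
Proof.
move=> [s ->] [t ->]; exists (s ++ t); apply/seteqP; split => x /=.
  by case=> -[c cs bx]; exists c => //; rewrite mem_cat cs ?orbT.
case=> c; rewrite mem_cat => /orP[cs|ct] bx; first by left; exists c.
by right; exists c.
Qed.

(** Distribute the intersection over the two finite unions: the intersection of
two basic sets is basic, with the systems concatenated. *)
Lemma semialgebraicI D (X Y : set 'rV[R]_D) :
  semialgebraic X -> semialgebraic Y -> semialgebraic (X `&` Y).
Proof.
move=> [s ->] [t ->].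
exists [seq (c.1 ++ c'.1, c.2 ++ c'.2) | c <- s, c' <- t].
apply/seteqP; split => x /=.
  case=> -[c cs [ex ix]] [c' ct [ex' ix']].
  exists (c.1 ++ c'.1, c.2 ++ c'.2); first by apply/allpairsP; exists (c, c').
  by split=> f /=; rewrite mem_cat => /orP[]; auto.
case=> _ /allpairsP[[c c'] /= [cs ct ->]] [/= ex ix].
by split; [exists c|exists c'] => //; split=> f fc; (apply: ex || apply: ix);
  rewrite mem_cat fc ?orbT.
Qed.

Lemma semialgebraic_eq0 D (F : 'rV[R]_D -> R) :
  polyfun F -> semialgebraic [set x | F x = 0].
Proof.
case=> f Ff; apply: semialgebraic_ext (semialgebraic_basic [:: f] [::]) => x /=.
rewrite Ff; split=> [[+ _]|fx]; first by apply; rewrite inE.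
by split=> // g; rewrite inE => /eqP ->.
Qed.

Lemma semialgebraic_gt0 D (F : 'rV[R]_D -> R) :
  polyfun F -> semialgebraic [set x | 0 < F x].
Proof.
case=> f Ff; apply: semialgebraic_ext (semialgebraic_basic [::] [:: f]) => x /=.
rewrite Ff; split=> [[_]|fx]; first by apply; rewrite inE.
by split=> // g; rewrite inE => /eqP ->.
Qed.

Lemma semialgebraic_lt D (F G : 'rV[R]_D -> R) :
  polyfun F -> polyfun G -> semialgebraic [set x | F x < G x].
Proof.
move=> pF pG.
apply: semialgebraic_ext (semialgebraic_gt0 (polyfunB pG pF)) => x.
by rewrite /= subr_gt0.
Qed.

Lemma semialgebraic_eq D (F G : 'rV[R]_D -> R) :
  polyfun F -> polyfun G -> semialgebraic [set x | F x = G x].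
Proof.
move=> pF pG.
apply: semialgebraic_ext (semialgebraic_eq0 (polyfunB pF pG)) => x.
by split=> /= [/eqP|->]; rewrite ?subrr // subr_eq0 => /eqP.
Qed.

Lemma semialgebraic_le D (F G : 'rV[R]_D -> R) :
  polyfun F -> polyfun G -> semialgebraic [set x | F x <= G x].
Proof.
move=> pF pG.
have -> : [set x | F x <= G x] = [set x | F x < G x] `|` [set x | F x = G x].
  apply/seteqP; split => x /=; rewrite le_eqVlt.
    by case/orP=> [/eqP|]; [right|left].
  by case=> [->|->]; rewrite ?orbT ?eqxx.
by apply: semialgebraicU; [apply: semialgebraic_lt|apply: semialgebraic_eq].
Qed.

Lemma semialgebraic_neq D (F G : 'rV[R]_D -> R) :
  polyfun F -> polyfun G -> semialgebraic [set x | F x != G x].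
Proof.
move=> pF pG.
have -> : [set x | F x != G x] = [set x | F x < G x] `|` [set x | G x < F x].
  by apply/seteqP; split => x /=; rewrite neq_lt => /orP.
by apply: semialgebraicU; apply: semialgebraic_lt.
Qed.

(** * Semialgebraic sets are the first-order definable sets *)

(** The coordinates of a point as an assignment of values to the variables
['X_0], ['X_1], ... of a formula; out of range variables evaluate to [0]. *)
Definition env D (x : 'rV[R]_D) : seq R := [seq x 0 i | i <- enum 'I_D].

Lemma size_env D (x : 'rV[R]_D) : size (env x) = D.
Proof. by rewrite size_map size_enum_ord. Qed.

Lemma nth_env D (x : 'rV[R]_D) (i : 'I_D) : (env x)`_i = x 0 i.
Proof. by rewrite (nth_map i) ?size_enum_ord // nth_ord_enum. Qed.

Lemma env_row_mx D E (x : 'rV[R]_D) (y : 'rV[R]_E) :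
  env (row_mx x y) = env x ++ env y.
Proof.
apply: (@eq_from_nth _ 0) => [|i]; first by rewrite size_cat !size_env.
rewrite size_env => iDE; rewrite -[i]/(val (Ordinal iDE)) nth_env.
case: (split_ordP (Ordinal iDE)) => l ->; rewrite nth_cat size_env.
  by rewrite row_mxEl /= ltn_ord nth_env.
by rewrite row_mxEr /= ltnNge leq_addr addKn nth_env.
Qed.

Lemma envP D (s : seq R) : size s = D -> exists y : 'rV[R]_D, s = env y.
Proof.
move=> sD; exists (\row_i s`_i).
apply: (@eq_from_nth _ 0) => [|i]; first by rewrite size_env.
by rewrite sD => iD; rewrite (nth_env _ (Ordinal iD)) mxE.
Qed.

Lemma rterm_polyfun D (t : GRing.term R) :
  GRing.rterm t -> polyfun (fun x : 'rV[R]_D => GRing.eval (env x) t).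
Proof.
elim: t => //=.
- move=> i _; have [iD|Di] := ltnP i D.
    by apply: polyfun_ext (polyfun_coord _ (Ordinal iD)) => x; rewrite -nth_env.
  by apply: polyfun_ext (polyfun_cst _ 0) => x; rewrite nth_default ?size_env.
- by move=> c _; apply: polyfun_cst.
- by move=> c _; apply: polyfun_cst.
- by move=> t pt u pu /andP[/pt ? /pu ?]; apply: polyfunD.
- by move=> t pt /pt; apply: polyfunN.
- move=> t pt c /pt pt'; apply: polyfun_ext (polyfunM pt' (polyfun_cst _ c%:R)).
  by move=> x; rewrite mulr_natr.
- by move=> t pt u pu /andP[/pt ? /pu ?]; apply: polyfunM.
- by move=> t pt c /pt; apply: polyfunX.
Qed.

(** Converse of [rterm_polyfun]: write the polynomial as a term, monomial by
monomial. *)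
Lemma polyfun_term D (F : 'rV[R]_D -> R) :
  polyfun F -> exists t : GRing.term R, forall x, GRing.eval (env x) t = F x.
Proof.
case=> f Ff.
have prod_term (m : 'X_{1..D}) : exists t : GRing.term R, forall x : 'rV[R]_D,
    GRing.eval (env x) t = \prod_i x 0 i ^+ m i.
  elim: (index_enum _) => [|i r [t IHt]].
    by exists (GRing.Const 1) => x; rewrite big_nil.
  exists (GRing.Mul (GRing.Exp (GRing.Var R i) (m i)) t) => x.
  by rewrite big_cons -IHt -nth_env.
have [t tE] : exists t : GRing.term R, forall x : 'rV[R]_D,
    GRing.eval (env x) t = \sum_(m <- msupp f) f@_m * \prod_i x 0 i ^+ m i.
  elim: (msupp f) => [|m r [t IHt]].
    by exists (GRing.Const 0) => x; rewrite big_nil.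
  have [u uE] := prod_term m.
  by exists (GRing.Add (GRing.Mul (GRing.Const f@_m) u) t) => x;
    rewrite big_cons -IHt -uE.
by exists t => x; rewrite Ff mevalE tE.
Qed.

Definition definable D (X : set 'rV[R]_D) :=
  exists f : ord.formula R, forall x, ord.holds (env x) f <-> X x.

Lemma semialgebraic_definable D (X : set 'rV[R]_D) :
  semialgebraic X -> definable X.
Proof.
have def_all (s : seq {mpoly R[D]}) (rel : R -> Prop)
    (lit : GRing.term R -> ord.formula R) :
    (forall e t, ord.holds e (lit t) <-> rel (GRing.eval e t)) ->
    definable [set x : 'rV[R]_D | forall f, f \in s -> rel f.@[x 0]].
  move=> litP; elim: s => [|f s [g gP]]; first by exists (ord.Bool true).
  have [t tE] : exists t, forall x : 'rV[R]_D, GRing.eval (env x) t = f.@[x 0].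
    by apply: polyfun_term; exists f.
  exists (ord.And (lit t) g) => x /=; rewrite gP litP tE.
  by apply: iff_sym; apply: forall_in_cons.
case=> s ->; elim: s => [|c s [g gP]].
  by exists (ord.Bool false) => x; split => // -[].
have [e eP] := def_all c.1 (fun r => r = 0)
  (fun t => ord.Equal t (GRing.Const 0)) (fun _ _ => iff_refl _).
have [i iP] := def_all c.2 (fun r => 0 < r)
  (fun t => ord.Lt (GRing.Const 0) t) (fun _ _ => iff_refl _).
exists (ord.Or (ord.And e i) g) => x /=; rewrite gP eP iP.
by apply: iff_sym; apply: exists_cons.
Qed.

(** The complement is carried along so that the induction goes through
negations: the negation of an atom [=], [<], [<=] is again a finite union
of polynomial equations and strict inequalities. *)
Lemma qf_semialgebraic D (f : ord.formula R) :
  ord.qf_form f -> ord.rformula f ->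
  semialgebraic [set x : 'rV[R]_D | ord.qf_eval (env x) f] /\
  semialgebraic [set x : 'rV[R]_D | ~~ ord.qf_eval (env x) f].
Proof.
have E (b c : 'rV[R]_D -> bool) : b =1 c ->
    semialgebraic [set x | c x] -> semialgebraic [set x | b x].
  by move=> /funext ->.
have I (b c : 'rV[R]_D -> bool) : semialgebraic [set x | b x] ->
    semialgebraic [set x | c x] -> semialgebraic [set x | b x && c x].
  move=> sb sc; apply: semialgebraic_ext (semialgebraicI sb sc) => x.
  by split=> /= /andP.
have U (b c : 'rV[R]_D -> bool) : semialgebraic [set x | b x] ->
    semialgebraic [set x | c x] -> semialgebraic [set x | b x || c x].
  move=> sb sc; apply: semialgebraic_ext (semialgebraicU sb sc) => x.
  by split=> /= /orP.
elim: f => //=.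
- have sb b : semialgebraic [set _ : 'rV[R]_D | is_true b].
    case: b; first by apply: semialgebraic_ext (semialgebraicT D) => x; split.
    by apply: semialgebraic_ext (semialgebraic0 D) => x; split.
  by move=> b _ _; split; apply: sb.
- move=> t u _ /andP[/(@rterm_polyfun D) pt /(@rterm_polyfun D) pu]; split.
    by apply: semialgebraic_ext (semialgebraic_eq pt pu) => x; split=> /eqP.
  exact: semialgebraic_neq.
- move=> t u _ /andP[/(@rterm_polyfun D) pt /(@rterm_polyfun D) pu]; split.
    exact: semialgebraic_lt.
  by apply: E (semialgebraic_le pu pt) => x; rewrite leNgt.
- move=> t u _ /andP[/(@rterm_polyfun D) pt /(@rterm_polyfun D) pu]; split.
    exact: semialgebraic_le.
  by apply: E (semialgebraic_lt pu pt) => x; rewrite ltNge.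
- move=> f If g Ig /andP[/If{}If /Ig{}Ig] /andP[/If[? ?] /Ig[? ?]].
  split; first exact: I.
  by under [X in semialgebraic X]eq_set do rewrite negb_and; apply: U.
- move=> f If g Ig /andP[/If{}If /Ig{}Ig] /andP[/If[? ?] /Ig[? ?]].
  split; first exact: U.
  by under [X in semialgebraic X]eq_set do rewrite negb_or; apply: I.
- move=> f If g Ig /andP[/If{}If /Ig{}Ig] /andP[/If[? ?] /Ig[? ?]]; split.
    by under [X in semialgebraic X]eq_set do rewrite implybE; apply: U.
  under [X in semialgebraic X]eq_set do rewrite implybE negb_or negbK.
  exact: I.
- move=> f If /If{}If /If[? ?]; split=> //.
  by under [X in semialgebraic X]eq_set do rewrite negbK.
Qed.

(** Tarski and Seidenberg: eliminate the quantifiers of the defining formula.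
It is first rewritten without inverses, since only ring terms are
polynomials. *)
Lemma definable_semialgebraic D (X : set 'rV[R]_D) :
  definable X -> semialgebraic X.
Proof.
case=> f fX.
set q := ord.quantifier_elim
  (fun i c => qe_rcf.qfr_to_formula (qe_rcf.wproj i c)) (ord.to_rform f).
have /andP[qf_q r_q] : ord.qf_form q && ord.rformula q.
  apply: ord.quantifier_elim_wf (ord.to_rform_rformula f).
  exact: qe_rcf.wf_QE_wproj.
have [sq _] := qf_semialgebraic D qf_q r_q.
apply: semialgebraic_ext sq => x; split=> /=.
  by move=> qx; apply/fX; apply/qe_rcf.rcf_satP.
by move=> Xx; apply/(qe_rcf.rcf_satP (env x) f); apply/fX.
Qed.

(** Through formulas the complement is a negation; this avoids expanding the
complement of a union of basic sets. *)
Lemma semialgebraicC D (X : set 'rV[R]_D) :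
  semialgebraic X -> semialgebraic (~` X).
Proof.
move=> /semialgebraic_definable[f fX]; apply: definable_semialgebraic.
by exists (ord.Not f) => x /=; rewrite fX.
Qed.

(** Quantifying over the variables that follow the free ones appends values to
the assignment. *)
Lemma holds_exists_block E (f : ord.formula R) (s : seq R) :
  ord.holds s (foldr ord.Exists f (iota (size s) E)) <->
  exists2 t, size t = E & ord.holds (s ++ t) f.
Proof.
have set_end (r : seq R) a : set_nth 0 r (size r) a = rcons r a.
  by elim: r => //= b r ->.
elim: E s => [|E IHE] s /=.
  split=> [sf|[[|//] _]]; last by rewrite cats0.
  by exists [::]; rewrite ?cats0.
split=> [[a]|[[//|a t] [tE]]].
  rewrite set_end -(size_rcons s a) => /IHE[t <-].
  by rewrite cat_rcons => stf; exists (a :: t).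
rewrite -cat_rcons => stf; exists a.
by rewrite set_end -(size_rcons s a); apply/IHE; exists t.
Qed.

(** Stability under projection. Points of the product space are row vectors of
length [D + E]; [P] is written with the two blocks of coordinates separated. *)
Lemma semialgebraic_exists D E (P : 'rV[R]_D -> 'rV[R]_E -> Prop) :
  semialgebraic [set z : 'rV[R]_(D + E) | P (lsubmx z) (rsubmx z)] ->
  semialgebraic [set x | exists y, P x y].
Proof.
move=> /semialgebraic_definable[f fP]; apply: definable_semialgebraic.
exists (foldr ord.Exists f (iota D E)) => x /=.
have := holds_exists_block E f (env x); rewrite size_env => ->; split.
  case=> t /envP[y ->]; rewrite -env_row_mx => /fP /=.
  by rewrite row_mxKl row_mxKr; exists y.
case=> y Pxy; exists (env y); first by rewrite size_env.
by rewrite -env_row_mx; apply/fP; rewrite /= row_mxKl row_mxKr.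
Qed.

Lemma semialgebraic_forall D E (P : 'rV[R]_D -> 'rV[R]_E -> Prop) :
  semialgebraic [set z : 'rV[R]_(D + E) | P (lsubmx z) (rsubmx z)] ->
  semialgebraic [set x | forall y, P x y].
Proof.
move=> /semialgebraicC /(@semialgebraic_exists _ _ (fun x y => ~ P x y)).
move/semialgebraicC; apply: semialgebraic_ext => x; split=> /=.
  by move=> /forallNP nP y; apply: contrapT.
by move=> Px [y]; apply.
Qed.

(** Substituting polynomials in polynomials. With projections of row vectors
for [G], it renames, permutes or forgets variables. *)
Lemma semialgebraic_preimage D E (X : set 'rV[R]_E) (G : 'rV[R]_D -> 'rV[R]_E) :
  polymx G -> semialgebraic X -> semialgebraic [set x | X (G x)].
Proof.
move=> pG [s ->]; elim: s => [|c s IHs].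
  by apply: semialgebraic_ext (semialgebraic0 D) => x; split=> // -[].
have basic_all (t : seq {mpoly R[E]}) (rel : R -> Prop) :
    (forall F : 'rV[R]_D -> R,
      polyfun F -> semialgebraic [set x | rel (F x)]) ->
    semialgebraic [set x | forall f, f \in t -> rel f.@[G x 0]].
  move=> relP; elim: t => [|f t IHt].
    by apply: semialgebraic_ext (semialgebraicT D) => x; split.
  have pf : polyfun ((fun y : 'rV[R]_E => f.@[y 0]) \o G).
    by apply: polyfun_comp => //; exists f.
  apply: semialgebraic_ext (semialgebraicI (relP _ pf) IHt) => x.
  by apply: iff_sym; apply: forall_in_cons.
have sE := basic_all c.1 (fun r => r = 0) (@semialgebraic_eq0 D).
have sI := basic_all c.2 (fun r => 0 < r) (@semialgebraic_gt0 D).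
apply: semialgebraic_ext (semialgebraicU (semialgebraicI sE sI) IHs) => x.
by apply: iff_sym; apply: exists_cons.
Qed.

Lemma semialgebraic_forall_fin D (I : finType) (X : I -> set 'rV[R]_D) :
  (forall i, semialgebraic (X i)) -> semialgebraic [set x | forall i, X i x].
Proof.
move=> sX; have : semialgebraic [set x | forall i, i \in enum I -> X i x].
  elim: (enum I) => [|i r IHr].
    by apply: semialgebraic_ext (semialgebraicT D) => x; split.
  apply: semialgebraic_ext (semialgebraicI (sX i) IHr) => x.
  by apply: iff_sym; apply: forall_in_cons.
by apply: semialgebraic_ext => x; split=> /= Xx i => [|_]; apply: Xx;
  rewrite ?mem_enum.
Qed.

End Definability.

(** * Semialgebraic functions and infima of semialgebraic families *)

Section SemialgebraicFunctions.
Variable R : realType.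

Lemma semialgebraic_imply D (X Y : set 'rV[R]_D) :
  semialgebraic X -> semialgebraic Y -> semialgebraic [set x | X x -> Y x].
Proof.
move=> sX sY.
apply: semialgebraic_ext (semialgebraicU (semialgebraicC sX) sY) => x.
by split=> /= [[nX //|//]|XY]; have [Xx|nXx] := pselect (X x);
  [right; apply: XY|left].
Qed.

Lemma semialgebraic_exists1 D (P : 'rV[R]_D -> R -> Prop) :
  semialgebraic [set z : 'rV[R]_(D + 1) | P (lsubmx z) (rsubmx z 0 0)] ->
  semialgebraic [set x | exists c, P x c].
Proof.
move=> /(@semialgebraic_exists _ _ _ (fun x y => P x (y 0 0))).
apply: semialgebraic_ext => x; split=> /= -[c Pxc]; first by exists (c 0 0).
by exists c%:M; rewrite mxE eqxx.
Qed.

Lemma semialgebraic_forall1 D (P : 'rV[R]_D -> R -> Prop) :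
  semialgebraic [set z : 'rV[R]_(D + 1) | P (lsubmx z) (rsubmx z 0 0)] ->
  semialgebraic [set x | forall c, P x c].
Proof.
move=> /(@semialgebraic_forall _ _ _ (fun x y => P x (y 0 0))).
apply: semialgebraic_ext => x; split=> /= Px c; last exact: Px.
by have := Px c%:M; rewrite mxE eqxx.
Qed.

(** Only positive infima are kept, so that the default value [0] of the
infimum never occurs. *)
Definition inf_graph D (A : 'rV[R]_D -> set R) : set 'rV[R]_(D + 1) :=
  [set z | 0 < rsubmx z 0 0 /\ inf (A (lsubmx z)) = rsubmx z 0 0].

(** The infimum of a set that is empty or unbounded below is [0] by convention;
positivity of [c] rules this out. *)
Lemma pos_infP (A : set R) c : 0 < c ->
  inf A = c <->
  (forall e, A e -> c <= e) /\ (forall b, c < b -> exists e, A e /\ e < b).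
Proof.
move=> c0; split=> [Ac|[lbA gtA]].
  have iA : has_inf A.
    by apply: contrapT => /inf_out A0; rewrite -Ac A0 ltxx in c0.
  split=> [e Ae|b cb]; first by rewrite -Ac; apply: ge_inf Ae; case: iA.
  have b0 : 0 < b - inf A by rewrite subr_gt0 Ac.
  have [e Ae eb] := inf_adherent b0 iA.
  by exists e; split=> //; rewrite addrC subrK in eb.
have A0 : A !=set0.
  by have [|e [Ae _]] := gtA (c + 1); [rewrite ltrDl|exists e].
apply/eqP; rewrite eq_le lb_le_inf // andbT leNgt; apply/negP => /gtA[e [Ae]].
by rewrite ltNge ge_inf //; exists c.
Qed.

(** By [pos_infP] the graph of the infimum is defined by a formula in the
family [A]. *)
Lemma semialgebraic_inf D (A : 'rV[R]_D -> set R) :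
  semialgebraic [set z : 'rV[R]_(D + 1) | A (lsubmx z) (rsubmx z 0 0)] ->
  semialgebraic (inf_graph A).
Proof.
move=> sA.
have sA' E (f : 'rV[R]_E -> 'rV[R]_D) (g : 'rV[R]_E -> 'rV[R]_1) :
    polymx f -> polymx g -> semialgebraic [set z | A (f z) (g z 0 0)].
  move=> pf pg; apply: semialgebraic_ext
    (semialgebraic_preimage (polymx_row pf pg) sA) => z.
  by rewrite /= row_mxKl row_mxKr.
apply: (@semialgebraic_ext _ _ ([set z | 0 < rsubmx z 0 0] `&`
  ([set z | forall e, A (lsubmx z) e -> rsubmx z 0 0 <= e] `&`
   [set z | forall b, rsubmx z 0 0 < b -> exists e, A (lsubmx z) e /\ e < b]))).
  by move=> z; split=> -[z0 Az]; split=> //; apply/(pos_infP _ z0).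
apply: semialgebraicI; first exact/semialgebraic_gt0/polyfun_entry.
apply: semialgebraicI.
  apply/semialgebraic_forall1/semialgebraic_imply; first exact: sA'.
  by apply: semialgebraic_le; apply: polyfun_entry.
apply/semialgebraic_forall1/semialgebraic_imply.
  by apply: semialgebraic_lt; apply: polyfun_entry.
apply/semialgebraic_exists1/semialgebraicI.
  by apply: sA' => //; apply: polymx_lsub.
by apply: semialgebraic_lt; apply: polyfun_entry.
Qed.

Lemma graph_onP D (X : set 'rV[R]_D) (F : 'rV[R]_D -> R) z :
  graph_on X (fun x => (F x)%:M : 'rV_1) z <->
  X (lsubmx z) /\ F (lsubmx z) = rsubmx z 0 0.
Proof.
split=> [[x Xx ->]|[Xz Fz]].
  by rewrite row_mxKl row_mxKr mxE eqxx.
by exists (lsubmx z) => //; rewrite Fz -mx11_scalar hsubmxK.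
Qed.

(** It is enough to treat the graph: the domain is its projection. *)
Lemma semialgebraic_funP D (X : set 'rV[R]_D) (F : 'rV[R]_D -> R) :
  semialgebraic [set z : 'rV[R]_(D + 1) |
    X (lsubmx z) /\ F (lsubmx z) = rsubmx z 0 0] ->
  semialgebraic_fun X F.
Proof.
move=> sF; split => //; first 1 last.
- exact: semialgebraicT.
- by apply: semialgebraic_ext sF => z; rewrite graph_onP.
- apply: semialgebraic_ext (semialgebraic_exists1
    (P := fun x c => X x /\ F x = c) sF) => x.
  by split=> [[c []] //|Xx]; exists (F x).
Qed.

(** * Semialgebraic functions are algebraic *)

Lemma meval_line D (g : {mpoly R[D]}) (x v : 'rV[R]_D) :
  exists q : {poly R}, forall t, q.[t] = g.@[(x + t *: v) 0].
Proof.
exists (\sum_(m <- msupp g) (g@_m)%:P *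
          \prod_i ((x 0 i)%:P + (v 0 i)%:P * 'X) ^+ m i) => t.
rewrite mevalE horner_sum; apply: eq_bigr => m _.
rewrite hornerM hornerC horner_prod; congr (_ * _); apply: eq_bigr => i _.
by rewrite horner_exp !hornerE !mxE mulrC.
Qed.

(** On the line through [x] with direction [v] the left-hand sides become
univariate polynomials, which are continuous at [0]. *)
Lemma ineqs_line_open D (gs : seq {mpoly R[D]}) (x v : 'rV[R]_D) :
  (forall g, g \in gs -> 0 < g.@[x 0]) ->
  exists2 e, 0 < e & forall t, 0 < t < e ->
    forall g, g \in gs -> 0 < g.@[(x + t *: v) 0].
Proof.
elim: gs => [|g gs IHgs] gt0; first by exists 1.
have [|e e0 eP] := IHgs.
  by move=> h hgs; apply: gt0; rewrite inE hgs orbT.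
have [q qE] := meval_line g x v.
have q0 : 0 < q.[0] by rewrite qE scale0r addr0 gt0 ?mem_head.
have [d d0 dP] := poly_cont 0 q q0.
exists (Num.min d e) => [|t]; first by rewrite lt_min d0.
rewrite lt_min => /and3P[t0 td te] h; rewrite inE => /orP[/eqP ->|]; last first.
  by apply: eP; rewrite t0.
rewrite -qE; have := dP t; rewrite subr0 gtr0_norm // => /(_ td).
by rewrite ltr_norml => /andP[]; rewrite ltrBrDl subrr.
Qed.

(** Each basic piece of the graph satisfies a nonzero polynomial equation. If
all its equations are trivial, then a point of the piece can be moved slightly
in the last coordinate without leaving it, and the graph would contain two
points over the same [x]. The product of these equations vanishes on the
graph. *)
Lemma semialgebraic_algebraic D (X : set 'rV[R]_D) (F : 'rV[R]_D -> R) :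
  semialgebraic_fun X F -> algebraic_fun X F.
Proof.
case=> _ _ _ [s sE].
pose U (s' : seq (seq {mpoly R[D + 1]} * seq {mpoly R[D + 1]}))
  (z : 'rV[R]_(D + 1)) := exists2 c, c \in s' & basic_semialgebraic c.1 c.2 z.
have sX x : X x -> U s (row_mx x (F x)%:M).
  move=> Xx; have : graph_on X (fun x => (F x)%:M : 'rV_1) (row_mx x (F x)%:M).
    by exists x.
  by rewrite sE.
have {sE} sF z : U s z -> F (lsubmx z) = rsubmx z 0 0.
  move=> sz; suff /graph_onP[] : graph_on X (fun x => (F x)%:M : 'rV_1) z by [].
  by rewrite sE.
suff [P P0 PF] : exists2 P : {mpoly R[D + 1]}, P != 0 &
    forall z, U s z -> P.@[z 0] = 0.
  by exists P; split=> // x Xx; apply/PF/sX.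
elim: s sF {sX} => [|c s IHs] sF.
  by exists 1; rewrite ?oner_neq0 // => z [].
have [|P P0 PF] := IHs.
  by move=> z [c' c's bz]; apply: sF; exists c'; rewrite // inE c's orbT.
have [Q Q0 QF] : exists2 Q : {mpoly R[D + 1]}, Q != 0 &
    forall z, basic_semialgebraic c.1 c.2 z -> Q.@[z 0] = 0.
  have [/hasP[f fc f0]|/hasPn c0] := boolP (has (fun f => f != 0) c.1).
    by exists f => // z [+ _]; apply.
  (* All equations are trivial: the piece is empty, and [1] vanishes on it. *)
  exists 1; rewrite ?oner_neq0 // => z cz; exfalso.
  pose v : 'rV[R]_(D + 1) := row_mx 0 1%:M.
  have [e e0 eP] := ineqs_line_open v cz.2.
  have t0 : 0 < e / 2%:R < e.
    by rewrite divr_gt0 ?ltr0n //= gtr_pMr // invf_lt1 ?ltr1n ?ltr0n.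
  have cz' : basic_semialgebraic c.1 c.2 (z + e / 2%:R *: v).
    split; last exact: eP.
    by move=> f /c0; rewrite negbK => /eqP ->; rewrite meval0.
  have Fz := sF z (ex_intro2 _ _ c (mem_head _ _) cz).
  have := sF _ (ex_intro2 _ _ c (mem_head _ _) cz').
  have -> : lsubmx (z + e / 2%:R *: v) = lsubmx z.
    by rewrite linearD linearZ /= row_mxKl scaler0 addr0.
  rewrite Fz linearD linearZ /= row_mxKr !mxE eqxx mulr1 => /eqP.
  by rewrite eq_sym addrC -subr_eq0 addrK gt_eqF //; case/andP: t0.
exists (P * Q); first by rewrite mulf_neq0.
move=> z /exists_cons[/QF Q_z|/PF P_z]; rewrite mevalM.
  by rewrite Q_z mulr0.
by rewrite P_z mul0r.
Qed.

End SemialgebraicFunctions.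

(** * Positive definite matrices *)

Section PositiveDefinite.
Variable R : realType.

(** Positive definiteness is a first-order condition: a universally quantified
vector and finitely many polynomial conditions. *)
Lemma semialgebraic_posdef D n (M : 'rV[R]_D -> 'M[R]_n) :
  polymx M -> semialgebraic [set x | posdef_mx (M x)].
Proof.
move=> pM.
apply: (@semialgebraicI _ _ [set x | (M x)^T = M x]
  [set x | forall y : 'cV_n, y != 0 -> 0 < (y^T *m M x *m y) 0 0]).
  have sM (i j : 'I_n) : semialgebraic [set x | M x j i = M x i j].
    by apply: semialgebraic_eq; apply: pM.
  apply: semialgebraic_ext
    (semialgebraic_forall_fin (fun i => semialgebraic_forall_fin (sM i))) => x.
  split=> [Mx|/matrixP Mx i j] /=; first by apply/matrixP=> i j; rewrite mxE Mx.
  by rewrite -Mx mxE.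
apply: (@semialgebraic_ext _ _ [set x | forall y : 'rV[R]_n,
    ~ (forall i, y 0 i = 0) -> 0 < (y *m M x *m y^T) 0 0]).
  move=> x; split=> /= Mx y.
    move=> y0; have := Mx y^T; rewrite trmxK; apply=> yT0; case/eqP: y0.
    by apply/colP=> i; have := yT0 i; rewrite !mxE.
  move=> y0; have := Mx y^T; rewrite trmxK; apply; apply/eqP => yT0.
  by apply: y0 => i; have /colP/(_ i) := yT0; rewrite !mxE.
apply: semialgebraic_forall; apply: semialgebraic_imply.
  apply/semialgebraicC/semialgebraic_forall_fin => i; apply: semialgebraic_eq0.
  exact: polyfun_entry.
apply/semialgebraic_gt0/polyfun_entry/polymxM/polymx_tr => //.
by apply: polymxM => // i j; apply: (@polyfun_comp _ _ _ (fun x => M x i j)).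
Qed.

(** On the segment from the identity to [Y] all matrices are positive definite,
hence invertible, so the determinant, a polynomial in the parameter, keeps
the sign that it has at the identity. *)
Lemma posdef_det_gt0 n (Y : 'M[R]_n) : posdef_mx Y -> 0 < \det Y.
Proof.
case=> _ Ypos.
pose M t : 'M[R]_n := (1 - t)%:M + t *: Y.
pose q := \det ((1 - 'X)%:M + 'X *: map_mx polyC Y).
have qE t : q.[t] = \det (M t).
  rewrite -[q.[t]]/(horner_eval t q) -det_map_mx; congr (\det _).
  apply/matrixP => i j; rewrite !mxE /horner_eval /=.
  by rewrite horner_evalE hornerD hornerMn hornerM hornerC !hornerE.
(* A root in the unit interval would give a singular [M t]. *)
rewrite ltNge; apply/negP => Y0.
have [||t /andP[t0 t1]] := @poly_ivt _ (- q) 0 1; first exact: ler01.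
  rewrite !hornerN !qE oppr_le0 oppr_ge0 /M subrr subr0 scale0r scale1r addr0.
  by rewrite raddf0 add0r det1 ler01.
rewrite /root hornerN oppr_eq0 qE => /det0P[v v0 vM].
have v2_ge0 : 0 <= (v *m v^T) 0 0.
  by rewrite mxE sumr_ge0 // => i _; rewrite !mxE -expr2 sqr_ge0.
have v2 : 0 < (v *m v^T) 0 0.
  rewrite lt_neqAle v2_ge0 andbT eq_sym; apply: contra v0.
  rewrite mxE psumr_eq0; last by move=> i _; rewrite !mxE -expr2 sqr_ge0.
  move=> /allP v0; apply/eqP/rowP => i; apply/eqP; rewrite mxE.
  by have := v0 i (mem_index_enum _); rewrite !mxE mulf_eq0 orbb.
have vY : 0 < (v *m Y *m v^T) 0 0.
  by have := Ypos v^T; rewrite trmxK; apply; rewrite trmx_eq0.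
have : (1 - t) *: (v *m v^T) + t *: (v *m Y *m v^T) = 0.
  rewrite -[RHS](mul0mx _ v^T) -vM /M mulmxDr mulmxDl mul_mx_scalar.
  by rewrite -scalemxAr -!scalemxAl.
move: {v2_ge0} (v *m v^T) v2 (v *m Y *m v^T) vY => a a0 b b0 /matrixP/(_ 0 0).
rewrite !mxE => /eqP; apply/negP; rewrite gt_eqF //.
move: t0; rewrite le_eqVlt => /orP[/eqP <-|t0].
  by rewrite subr0 mul1r mul0r addr0.
by rewrite ltr_wpDl ?mulr_gt0 // mulr_ge0 ?subr_ge0 // ltW.
Qed.

End PositiveDefinite.

(** * The capacity of a quiver datum *)

Lemma common_denominator (I : finType) (p : I -> rat) :
  (forall i, 0 < p i) ->
  exists N (a : I -> nat), (0 < N)%N /\ forall i, p i * N%:R = (a i)%:R.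
Proof.
move=> p0; exists (\prod_i `|denq (p i)|)%N.
exists (fun i => `|numq (p i)| * \prod_(j | j != i) `|denq (p j)|)%N; split.
  by rewrite prodn_gt0 // => i; rewrite absz_gt0 denq_neq0.
move=> i; rewrite (bigD1 i) //= !natrM mulrA; congr (_ * _).
by rewrite !pmulrn !gez0_abs ?denq_ge0 ?numq_ge0 ?ltW // -numqE.
Qed.

Section MatrixFamilies.
Variables (R : realType) (m : nat) (n : 'I_m -> nat).

Local Notation entry := {j : 'I_m & ('I_(n j) * 'I_(n j))%type}.

Definition family_dim : nat := #|{: entry}|.

Local Notation index j r c :=
  (enum_rank (Tagged (fun j => ('I_(n j) * 'I_(n j))%type) (r, c) : entry)).

(** Quantification over families of square matrices of different sizes is
quantification over one long row vector holding all the entries. *)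
Definition mx_family (y : 'rV[R]_family_dim) j : 'M[R]_(n j) :=
  \matrix_(r, c) y 0 (index j r c).

Lemma mx_family_surj (Y : forall j, 'M[R]_(n j)) : exists y, mx_family y = Y.
Proof.
exists (\row_l let: existT j (r, c) := enum_val l in Y j r c).
apply: functional_extensionality_dep => j; apply/matrixP => r c.
by rewrite !mxE enum_rankK.
Qed.

Lemma polymx_family D (G : 'rV[R]_D -> 'rV[R]_family_dim) j :
  polymx G -> polymx (fun x => mx_family (G x) j).
Proof.
by move=> pG r c; apply: polyfun_ext (pG 0 (index j r c)) => x; rewrite mxE.
Qed.

End MatrixFamilies.

Section Capacity.
Variables (R : realType) (k m : nat) (d : 'I_k -> nat) (n : 'I_m -> nat).
Variables (A : 'I_k -> 'I_m -> finType) (p : 'I_m -> rat).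
Hypothesis p_gt0 : forall j, 0 < p j.

Local Notation rep := (quiver_rep R d n A).
Local Notation dim := (quiver_dim d n A).

Lemma polymx_unvec D (G : 'rV[R]_D -> 'rV[R]_dim) i j (a : A i j) :
  polymx G -> polymx (fun x => quiver_unvec (G x) a).
Proof.
move=> pG r c; apply: polyfun_ext (pG 0 (coord_index (Tagged
  (fun i' => {j' : 'I_m & (A i' j' * ('I_(n j') * 'I_(d i')))%type})
  (Tagged (fun j' => (A i j' * ('I_(n j') * 'I_(d i)))%type) (a, (r, c)))))).
by move=> x; rewrite mxE.
Qed.

(** The numerator of [cap_ratio], which is polynomial in [V] and [Y]. *)
Definition cap_num (V : rep) (Y : forall j, 'M[R]_(n j)) : R :=
  \prod_(i < k) \det (\sum_(j < m) (ratr (p j) : R) *: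
       \sum_(a : A i j) (V i j a)^T *m Y j *m V i j a).

(** The denominator of the ratio is [\prod_j det (Y j) `^ p j], the positive
[N]-th root of the polynomial [\prod_j det (Y j) ^+ a j]. An auxiliary
variable [w] for it removes both the real powers and the division. *)
Lemma cap_ratioP N (a : 'I_m -> nat) (V : rep) (Y : forall j, 'M[R]_(n j)) c :
  (0 < N)%N -> (forall j, p j * N%:R = (a j)%:R) ->
  (forall j, posdef_mx (Y j)) ->
  c = cap_ratio V p Y <->
  exists w, [/\ 0 < w, w ^+ N = \prod_j \det (Y j) ^+ a j &
    c * w = cap_num V Y].
Proof.
move=> N0 paN Ypos; pose w0 : R := \prod_j \det (Y j) `^ ratr (p j).
have w0_gt0 : 0 < w0.
  by apply: prodr_gt0 => j _; apply/powR_gt0/posdef_det_gt0.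
have w0N : w0 ^+ N = \prod_j \det (Y j) ^+ a j.
  rewrite -prodrXl; apply: eq_bigr => j _.
  have Y0 := posdef_det_gt0 (Ypos j).
  rewrite -powR_mulrn ?powR_ge0 // -powRrM -powR_mulrn ?ltW //; congr (_ `^ _).
  by rewrite -[N%:R](ratr_nat R) -rmorphM /= paN ratr_nat.
rewrite /cap_ratio -/(cap_num V Y) -/w0; split=> [->|[w [w_gt0 wN <-]]].
  by exists w0; split=> //; rewrite mulfVK // gt_eqF.
have -> : w = w0 by apply: (pexpIrn N0); rewrite ?nnegrE ?ltW // wN.
by rewrite mulfK // gt_eqF.
Qed.

Definition cap_values (x : 'rV[R]_dim) : set R :=
  [set c | exists2 Y : forall j, 'M[R]_(n j),
     (forall j, posdef_mx (Y j)) & c = cap_ratio (quiver_unvec x) p Y].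

Lemma semialgebraic_cap_values :
  semialgebraic [set z : 'rV[R]_(dim + 1) |
    cap_values (lsubmx z) (rsubmx z 0 0)].
Proof.
have [N [a [N0 paN]]] := common_denominator p_gt0.
apply: (@semialgebraic_ext _ _ [set z : 'rV[R]_(dim + 1) | exists y,
    (forall j, posdef_mx (mx_family y j)) /\ exists w,
    0 < w /\ (w ^+ N = \prod_j \det (mx_family y j) ^+ a j /\
    rsubmx z 0 0 * w = cap_num (quiver_unvec (lsubmx z)) (mx_family y))]).
  move=> z; split=> /= [[y [ypos [w [w0 [wN cw]]]]]|[Y Ypos]].
    by exists (mx_family y) => //; apply/(cap_ratioP _ _ N0 paN ypos); exists w.
  have [y yY] := mx_family_surj Y; rewrite -{}yY in Ypos *.
  move=> /(cap_ratioP _ _ N0 paN Ypos)[w [w0 wN cw]].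
  by exists y; split=> //; exists w.
apply/semialgebraic_exists/semialgebraicI.
  apply: semialgebraic_forall_fin => j; apply: semialgebraic_posdef.
  exact: polymx_family.
apply/semialgebraic_exists1/semialgebraicI.
  exact/semialgebraic_gt0/polyfun_entry.
have pY j : polymx (fun z : 'rV[R]_(dim + 1 + _ + 1) =>
    mx_family (n := n) (rsubmx (lsubmx z)) j).
  exact: polymx_family.
apply: semialgebraicI; apply: semialgebraic_eq.
- exact/polyfunX/polyfun_entry.
- by apply: polyfun_prod => j _; apply/polyfunX/polyfun_det.
- by apply: polyfunM; apply: polyfun_entry => //; apply/polymx_rsub/polymx_lsub.
- apply: polyfun_prod => i _; apply/polyfun_det/polymx_sum => j.
  apply: polymxZ; first exact: polyfun_cst.
  apply: polymx_sum => b.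
  have pV : polymx (fun z : 'rV[R]_(dim + 1 + family_dim n + 1) =>
      quiver_unvec (lsubmx (lsubmx (lsubmx z))) b).
    by apply/polymx_unvec/polymx_lsub/polymx_lsub.
  by apply: polymxM => //; apply: polymxM => //; apply: polymx_tr.
Qed.

Lemma feasible_setE (x : 'rV[R]_dim) :
  feasible_set p x <-> 0 < capacity (quiver_unvec x) p.
Proof.
split=> [[V Vp <-]|xp]; first by rewrite quiver_vecK.
by exists (quiver_unvec x) => //; rewrite quiver_unvecK.
Qed.

Lemma semialgebraic_cap_graph :
  semialgebraic [set z : 'rV[R]_(dim + 1) | feasible_set p (lsubmx z) /\
    capacity (quiver_unvec (lsubmx z)) p = rsubmx z 0 0].
Proof.
apply: semialgebraic_ext (semialgebraic_inf semialgebraic_cap_values) => z.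
rewrite /= feasible_setE /inf_graph /=.
rewrite -[inf _]/(capacity (quiver_unvec (lsubmx z)) p).
by split=> -[z0 zE]; split=> //; move: z0; rewrite zE.
Qed.

Lemma semialgebraic_capacity :
  semialgebraic_fun (@feasible_set R k m d n A p)
    (fun x => capacity (quiver_unvec x) p).
Proof. exact/semialgebraic_funP/semialgebraic_cap_graph. Qed.

(** With [c] the capacity, [b = 1 / sqrt c] means [0 < b] and
[b ^+ 2 * c = 1]; the value [c] is quantified existentially. *)
Lemma semialgebraic_BL : semialgebraic_fun (@feasible_set R k m d n A p)
  (fun x => fine (BL_constant (quiver_unvec x) p)).
Proof.
apply: semialgebraic_funP.
have BLP (c b : R) : 0 < c ->
  fine ((Num.sqrt c)%:E^-1)%E = b <-> 0 < b /\ b ^+ 2 * c = 1.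
  move=> c0; rewrite fine_invr; have s0 : 0 < Num.sqrt c by rewrite sqrtr_gt0.
  split=> [<-|[b0 bc]].
    rewrite invr_gt0; split=> //.
    by rewrite -{2}(sqr_sqrtr (ltW c0)) -exprMn mulVf ?expr1n // gt_eqF.
  suff -> : Num.sqrt c = b^-1 by rewrite invrK.
  rewrite -[c](mulKf (x := b ^+ 2)) ?expf_neq0 ?gt_eqF // bc mulr1 -exprVn.
  by rewrite sqrtr_sqr gtr0_norm ?invr_gt0.
apply: (@semialgebraic_ext _ _ [set z : 'rV[R]_(dim + 1) | exists c,
  (feasible_set p (lsubmx z) /\ capacity (quiver_unvec (lsubmx z)) p = c) /\
  (0 < rsubmx z 0 0 /\ (rsubmx z 0 0) ^+ 2 * c = 1)]).
  move=> z; split=> /= [[c [[zf <-] /BLP zc]]|[zf zE]].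
    by split=> //; apply: zc; apply/feasible_setE.
  exists (capacity (quiver_unvec (lsubmx z)) p); split=> //.
  by apply/BLP => //; apply/feasible_setE.
apply/semialgebraic_exists1/semialgebraicI.
  have pG := polymx_row (@polymx_llproj R dim 1 1)
    (@polymx_rproj R (dim + 1) 1).
  apply: semialgebraic_ext
    (semialgebraic_preimage pG semialgebraic_cap_graph) => z.
  by rewrite /= row_mxKl row_mxKr.
apply: semialgebraicI; first exact/semialgebraic_gt0/polyfun_entry.
apply: semialgebraic_eq; last exact: polyfun_cst.
by apply: polyfunM; [apply: polyfunX|]; apply: polyfun_entry.
Qed.

End Capacity.

Theorem theorem1 (R : realType) (k m : nat) (d : 'I_k -> nat) (n : 'I_m -> nat)
    (A : 'I_k -> 'I_m -> finType) (p : 'I_m -> rat)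
    (hk : (1 <= k)%N) (hm : (1 <= m)%N)
    (hd : forall i, (0 < d i)%N) (hn : forall j, (0 < n j)%N)
    (hp : forall j, 0 < p j)
    (hdim : (\sum_(i < k) (d i)%:R = \sum_(j < m) p j * (n j)%:R :> rat)) :
  [/\ semialgebraic_fun (@feasible_set R k m d n A p)
        (fun x => capacity (quiver_unvec x) p),
      exists P : {mpoly R[((\sum_(i < k) \sum_(j < m) #|A i j| * d i * n j) + 1)%N]},
        P != 0 /\
        forall V : quiver_rep R d n A, feasible V p ->
          P.@[row_mx (quiver_vec V) (capacity V p)%:M 0] = 0 &
      k = 1%N -> (forall i j, #|A i j| = 1%N) ->
        semialgebraic_fun (@feasible_set R k m d n A p)
          (fun x => fine (BL_constant (quiver_unvec x) p)) /\
        algebraic_fun (@feasible_set R k m d n A p)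
          (fun x => fine (BL_constant (quiver_unvec x) p))].
Proof.
split.
- exact: semialgebraic_capacity.
- have [P [P0 PF]] :=
    semialgebraic_algebraic (semialgebraic_capacity R d n A hp).
  exists P; split=> // V Vp; rewrite -{2}(quiver_vecK V).
  by apply: PF; exists V.
- move=> _ _; split; first exact: semialgebraic_BL.
  exact/semialgebraic_algebraic/semialgebraic_BL.
Qed.
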